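(* Let $N,k$ be positive integers with $N\ge 2k+1$ and let $\mathcal P$ be the Petersen graph. Assume that all roots of $D_{k,2}(x)$ and $D_{k,5}(x)$ are simple. Then, for $a\in V(\mathcal P)$ and $0\le\ell\le N-1$, we have $$h_{C_N^k\square\mathcal P}((0,a),(\ell,a))=\frac{2k+3}{2k}h_{C_N^k}(0,\ell)-\frac{N(2k+3)}{2}\left(5\mathcal A_{k,2}^{(N)}(\ell)+4\mathcal A_{k,5}^{(N)}(\ell)\right).$$ In particular, when $k=1$, $$h_{C_N\square\mathcal P}((0,a),(\ell,a))=\frac52\,\ell(N-\ell)+5N\left(\frac{5}{\sqrt6}\frac{V_\ell^{(2)}V_{N-\ell}^{(2)}}{V_N^{(2)}}+\frac43\frac{V_\ell^{(5)}V_{N-\ell}^{(5)}}{V_N^{(5)}}\right),$$ where $V_0^{(2)}=V_0^{(5)}=0$, $V_1^{(2)}=V_1^{(5)}=1$, $V_{n+2}^{(2)}=\sqrt6\,V_{n+1}^{(2)}-V_n^{(2)}$ and $V_{n+2}^{(5)}=3V_{n+1}^{(5)}-V_n^{(5)}$.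
   Context: All graphs are finite, simple and undirected; $\mathbb Z_N=\mathbb Z/N\mathbb Z$. $C_N^k$ is the graph with vertex set $\mathbb Z_N$ in which $x,y$ are adjacent iff $x-y\equiv\pm s\pmod N$ for some $1\le s\le k$; $C_N=C_N^1$. The Cartesian product $C_N^k\square G$ has vertex set $\mathbb Z_N\times V(G)$, with $(x,a)$ and $(y,b)$ adjacent iff ($a=b$ and $x,y$ are adjacent in $C_N^k$) or ($x=y$ and $a,b$ are adjacent in $G$). For a finite connected graph $Y$ and $u,v\in V(Y)$, $h_Y(u,v)$ is the expected value of $T_v=\inf\{t\ge 0: Z_t=v\}$ for the simple random walk $(Z_t)$ on $Y$ started at $u$ (each step moves to a uniformly random neighbour). For $\nu>0$, $D_{k,\nu}(x)=k+\frac{\nu}{2}-\sum_{s=1}^{k}T_s\left(\frac{x}{2}\right)$, where $T_s$ is the Chebyshev polynomial of the first kind; it has degree $k$. When its roots are simple, they are denoted $\phi_{\nu,1},\ldots,\phi_{\nu,k}\in\mathbb C$, and one chooses complex numbers with $\rho_{\nu,c}+\rho_{\nu,c}^{-1}=\phi_{\nu,c}$, $\rho_{\nu,c}=\eta_{\nu,c}^{2}$, and puts $\gamma_{\nu,c}=\eta_{\nu,c}+\eta_{\nu,c}^{-1}$. The sequence $(V_n^{(\nu,c)})_{n\ge0}$ is defined by $V_0^{(\nu,c)}=0$, $V_1^{(\nu,c)}=1$, $V_{n+2}^{(\nu,c)}=\gamma_{\nu,c}V_{n+1}^{(\nu,c)}-V_n^{(\nu,c)}$, and $$\mathcal A_{k,\nu}^{(N)}(\ell)=\sum_{c=1}^{k}\frac{1}{\gamma_{\nu,c}D_{k,\nu}'(\phi_{\nu,c})}\frac{V_\ell^{(\nu,c)}V_{N-\ell}^{(\nu,c)}}{V_N^{(\nu,c)}}.$$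 *)

(* Defs.v *)
From mathcomp Require Import all_boot all_order all_algebra.
From mathcomp Require Import complex.
From mathcomp Require Import all_classical all_reals all_analysis.
Set Implicit Arguments.
Unset Strict Implicit.
Unset Printing Implicit Defensive.
Import Order.TTheory GRing.Theory Num.Theory.
Local Open Scope ring_scope.

(* A finite simple graph is a symmetric irreflexive relation on a finType. *)

(* The vertex type 'Z_N is the ring Z/NZ only when 1 < N, and the relation is
   irreflexive only when k < N; both follow from 0 < k and 2 * k + 1 <= N. *)
Definition circulant (N k : nat) : rel 'Z_N := fun x y =>
  [exists s : 'I_k.+1, (0 < s)%N && ((x - y == s%:R) || (x - y == - s%:R))].

Definition cartesian_product (V W : finType) (e : rel V) (f : rel W) :
    rel (V * W)%type := fun p q =>
  ((p.2 == q.2) && e p.1 q.1) || ((p.1 == q.1) && f p.2 q.2).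

(* The Petersen graph as the Kneser graph K(5, 2). *)
Definition petersen_vertex : finType := {A : {set 'I_5} | #|A| == 2}.
Definition petersen : rel petersen_vertex := fun A B =>
  [disjoint (val A : {set 'I_5}) & (val B : {set 'I_5})].

Lemma circulant_sym N k : symmetric (@circulant N k).
Proof.
move=> x y; apply: eq_existsb => s.
by rewrite -(opprB y x) eqr_oppLR eqr_opp orbC.
Qed.

Lemma circulant_irr N k : (k < N)%N -> irreflexive (@circulant N k).
Proof.
move=> kN x; apply/negbTE/existsPn => s; rewrite negb_and.
case: posnP => //= s0; rewrite subrr -[0 == - _]eqr_opp opprK oppr0 orbb.
have sN : (s < N)%N by rewrite (leq_trans _ kN).
rewrite eq_sym -val_eqE /= val_Zp_nat ?modn_small -?lt0n //.
exact: leq_ltn_trans sN.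
Qed.

Lemma petersen_sym : symmetric petersen.
Proof. by move=> A B; rewrite /petersen disjoint_sym. Qed.

Lemma petersen_irr : irreflexive petersen.
Proof.
move=> [A /= A2]; rewrite /petersen /= -setI_eq0 finset.setIid -cards_eq0.
by rewrite (eqP A2).
Qed.

Lemma cartesian_product_sym (V W : finType) (e : rel V) (f : rel W) :
  symmetric e -> symmetric f -> symmetric (cartesian_product e f).
Proof.
move=> es fs p q; rewrite /cartesian_product es fs.
by rewrite (eq_sym p.1) (eq_sym p.2).
Qed.

Lemma cartesian_product_irr (V W : finType) (e : rel V) (f : rel W) :
  irreflexive e -> irreflexive f -> irreflexive (cartesian_product e f).
Proof. by move=> ei fi p; rewrite /cartesian_product ei fi !andbF. Qed.

Local Open Scope classical_set_scope.

Section random_walk.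
Context {d : measure_display} {T : measurableType d} {R : realType}.
Variables (P : probability T R) (V : finType).
Implicit Types (e : rel V) (Z : nat -> T -> V).

Definition walk_step e (x y : V) : R :=
  (e x y)%:R / #|[set z | e x z]%SET|%:R.

Definition simple_random_walk e (u : V) Z : Prop :=
  [/\ forall t v, measurable (Z t @^-1` [set v]),
      P (Z 0 @^-1` [set u]) = 1%E &
      forall n (x : nat -> V) (y : V),
        P [set w | (forall i, (i <= n)%N -> Z i w = x i) /\ Z n.+1 w = y] =
        (P [set w | forall i, (i <= n)%N -> Z i w = x i]
           * (walk_step e (x n) y)%:E)%E].

(* The infimum of the empty set is +oo. *)
Definition hitting_time Z (v : V) (w : T) : \bar R :=
  ereal_inf [set (t%:R%:E)%E | t in [set t : nat | Z t w = v]].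

Definition expected_hitting_time Z (v : V) : \bar R :=
  (\int[P]_w hitting_time Z v w)%E.

End random_walk.

Fixpoint chebyshevT_pair (A : nzRingType) (n : nat) : {poly A} * {poly A} :=
  if n is m.+1 then
    let: (p, q) := chebyshevT_pair A m in (q, 'X * q *+ 2 - p)
  else (1, 'X).

Definition chebyshevT (A : nzRingType) (n : nat) : {poly A} :=
  (chebyshevT_pair A n).1.

Lemma chebyshevT0 (A : nzRingType) : chebyshevT A 0 = 1.
Proof. by []. Qed.

Lemma chebyshevT1 (A : nzRingType) : chebyshevT A 1 = 'X.
Proof. by []. Qed.

Lemma chebyshevTSS (A : nzRingType) n :
  chebyshevT A n.+2 = 'X * chebyshevT A n.+1 *+ 2 - chebyshevT A n.
Proof. by rewrite /chebyshevT /=; case: chebyshevT_pair. Qed.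

Fixpoint lucasV_pair (A : nzRingType) (g : A) (n : nat) : A * A :=
  if n is m.+1 then
    let: (a, b) := lucasV_pair g m in (b, g * b - a)
  else (0, 1).

Definition lucasV (A : nzRingType) (g : A) (n : nat) : A := (lucasV_pair g n).1.

Lemma lucasV0 (A : nzRingType) (g : A) : lucasV g 0 = 0.
Proof. by []. Qed.

Lemma lucasV1 (A : nzRingType) (g : A) : lucasV g 1 = 1.
Proof. by []. Qed.

Lemma lucasVSS (A : nzRingType) (g : A) n :
  lucasV g n.+2 = g * lucasV g n.+1 - lucasV g n.
Proof. by rewrite /lucasV /=; case: lucasV_pair. Qed.

Section root_sum.
Variable F : fieldType.
Implicit Types (k : nat) (nu : F).

Definition polyD k nu : {poly F} :=
  (k%:R + nu / 2)%:P -
  \sum_(1 <= s < k.+1) (chebyshevT F s \Po (2^-1 *: 'X)).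

Definition simple_roots (p : {poly F}) : Prop :=
  forall z, root p z -> mup z p = 1%N.

(* The condition rho c != 0 is needed because 0^-1 = 0 in a fieldType. *)
Definition root_choice k nu (phi rho eta : 'I_k -> F) : Prop :=
  [/\ injective phi,
      forall z, root (polyD k nu) z <-> exists c, phi c = z,
      forall c, rho c != 0 /\ rho c + (rho c)^-1 = phi c &
      forall c, rho c = eta c ^+ 2].

Definition gamma k (eta : 'I_k -> F) (c : 'I_k) : F := eta c + (eta c)^-1.

Definition rootA k nu (phi eta : 'I_k -> F) (N l : nat) : F :=
  \sum_(c < k) 1 / (gamma eta c * (polyD k nu)^`().[phi c]) *
    (lucasV (gamma eta c) l * lucasV (gamma eta c) (N - l)
       / lucasV (gamma eta c) N).

End root_sum.

(* Main.v *)
Require Import Defs.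
From mathcomp Require Import all_boot all_order all_algebra.
From mathcomp Require Import complex.
From mathcomp Require Import all_classical all_reals all_analysis.
From mathcomp Require Import measurable_realfun ring lra zify.
Set Implicit Arguments.
Unset Strict Implicit.
Unset Printing Implicit Defensive.
Import Order.TTheory GRing.Theory Num.Theory.
Import numFieldNormedType.Exports.
Local Open Scope ring_scope.
Local Open Scope complex_scope.

(* A function [f] vanishing at [v] with [f x = 1 + sum_y p(x, y) f(y)] off [v]
   computes the expected hitting time of [v], so it is enough to exhibit such a
   function on the product.  The Laplacian of the Petersen graph has the
   eigenvalues 0, 2, 5, with spectral projections whose diagonal entries are
   1/10, 1/2, 2/5.  The eigenvalue 0 contributes the hitting function of
   [C_N^k]; an eigenvalue [nu > 0] contributes the function [g] on [Z_N] with
   [(L + nu) g = delta_0], where [L] is the Laplacian of [C_N^k].  If [S] is the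
   shift then [L + nu = 2 D(S + S^-1)], so [g] is obtained from the partial
   fraction expansion of [1 / D] and from the resolvent of [S + S^-1], which is
   [(rho^x + rho^(N-x)) / ((rho - rho^-1) (1 - rho^N))] at [rho + rho^-1]. *)

(** * Hitting times from harmonic functions *)

Section hitting_time_of_walk.
Local Open Scope classical_set_scope.
Context {d : measure_display} {T : measurableType d} {R : realType}.
Variables (P : probability T R) (V : finType).
Implicit Types (e : rel V) (Z : nat -> T -> V).

Let pr (A : set T) : R := fine (P A).

Lemma prK A : measurable A -> (pr A)%:E = P A.
Proof. by move=> mA; rewrite /pr fineK// fin_num_measure. Qed.

Lemma pr_ge0 A : 0 <= pr A.
Proof. by rewrite /pr fine_ge0. Qed.

Lemma pr_partition (I : finType) (X : T -> I) (A : set T) :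
  measurable A -> (forall i, measurable (X @^-1` [set i])) ->
  pr A = \sum_i pr (A `&` X @^-1` [set i]).
Proof.
move=> mA mX; apply: EFin_inj; rewrite prK// -sumEFin.
have mAX i : measurable (A `&` X @^-1` [set i]) by exact: measurableI.
under eq_bigr do rewrite prK//.
have {1}-> : A = \bigcup_(i in [set` enum I]) (A `&` X @^-1` [set i]).
  apply/seteqP; split=> [w Aw|w [i _ []]//].
  by exists (X w) => //=; rewrite mem_enum.
rewrite measure_fin_bigcup//.
- by rewrite -fsbig_seq ?enum_uniq// big_enum.
- by move=> i j _ _ [w [[_ <-] [_ <-]]].
Qed.

Lemma measurable_forall_le n (F : nat -> set T) :
  (forall i, measurable (F i)) ->
  measurable [set w | forall i, (i <= n)%N -> F i w].
Proof.
move=> mF.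
rewrite (_ : [set w | _] = \bigcap_(i in [set i | (i <= n)%N]) F i) //.
by apply: bigcap_measurable => //; exists 0%N.
Qed.

Definition avoids Z (v : V) n : set T :=
  [set w | forall i, (i <= n)%N -> Z i w <> v].

Lemma measurable_avoids Z v n :
  (forall t v, measurable (Z t @^-1` [set v])) -> measurable (avoids Z v n).
Proof.
move=> mZ; apply: (@measurable_forall_le n (fun i => ~` (Z i @^-1` [set v]))).
by move=> i; exact: measurableC.
Qed.

(** The [n]-th term is 1 exactly when [v] has not been hit by time [n], so the series counts the
    steps before the hit. If [v] is never hit, every term is 1 and the series diverges, matching the
    infimum of the empty set. *)
Lemma hitting_time_series Z v w :
  hitting_time Z v w = (\sum_(n <oo) (\1_(avoids Z v n) w)%:E)%E :> \bar R.
Proof.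
have [[t tv]|nv] := pselect (exists t, Z t w = v); last first.
  rewrite /hitting_time (_ : [set _ | _ in _] = set0) ?ereal_inf0; last first.
    by rewrite -subset0 => _ [t /= tv _]; apply: nv; exists t.
  apply/esym/eq_infty => A; have [m Am] : exists m : nat, A <= m%:R.
    by exists (Num.truncn A).+1; rewrite ltW// truncnS_gt.
  apply: (@le_trans _ _ m%:R%:E); first by rewrite lee_fin.
  apply: le_trans (nneseries_lim_ge m _); last by move=> *; rewrite lee_fin.
  rewrite (eq_bigr (fun=> 1%E)); first by rewrite big_mkord sumEFin sumr_const card_ord.
  by move=> i _; rewrite indicE mem_set// => j _ jv; apply: nv; exists j.
have ex : exists t, Z t w == v by exists t; apply/eqP.
case: (ex_minnP ex) => m /eqP mv mmin.
have -> : hitting_time Z v w = m%:R%:E :> \bar R.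
  apply/eqP; rewrite eq_le; apply/andP; split.
    by apply: ereal_inf_lbound; exists m.
  apply: le_ereal_inf_tmp => _ [s /= sv <-].
  by rewrite lee_fin ler_nat mmin//; apply/eqP.
rewrite (@nneseries_split _ _ 0 m)//=.
rewrite add0n eseries0 ?adde0; last first.
  move=> i mi _; rewrite indicE memNset//= => /(_ m mi); exact.
rewrite big_mkord (eq_bigr (fun=> 1%E)).
  by rewrite sumEFin sumr_const card_ord.
move=> i _; rewrite indicE mem_set//= => j ji jv.
have := mmin j; rewrite jv eqxx => /(_ isT).
by rewrite leqNgt (leq_ltn_trans ji).
Qed.

Lemma expected_hitting_timeE Z v :
  (forall t v, measurable (Z t @^-1` [set v])) ->
  expected_hitting_time P Z v = (\sum_(n <oo) P (avoids Z v n))%E.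
Proof.
move=> mZ; rewrite /expected_hitting_time.
under eq_integral do rewrite hitting_time_series.
rewrite integral_nneseries//; last first.
  by move=> n; apply/measurable_EFinP; apply: measurable_indic; exact: measurable_avoids.
apply: eq_eseriesr => n _.
by rewrite integral_indic ?setIT//; exact: measurable_avoids.
Qed.

(** The Markov property is given for full trajectories. The avoiding event is the disjoint union of
    the cylinders over the trajectories [t] that avoid [v]; the property applies to each cylinder,
    and regrouping by the last vertex gives the sum. *)
Lemma avoids_step e u Z v n y : simple_random_walk P e u Z ->
  pr (avoids Z v n `&` Z n.+1 @^-1` [set y]) =
  \sum_x pr (avoids Z v n `&` Z n @^-1` [set x]) * walk_step e x y.
Proof.
case=> mZ _ markov.
pose X w : {ffun 'I_n.+1 -> V} := [ffun i : 'I_n.+1 => Z i w].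
pose cyl (t : {ffun 'I_n.+1 -> V}) :=
  [set w | forall i, (i <= n)%N -> Z i w = t (inord i)].
have cylE t : X @^-1` [set t] = cyl t.
  apply/seteqP; split=> w /=.
    by move=> <- i lin; rewrite ffunE inordK.
  move=> Zt; apply/ffunP => i; rewrite ffunE Zt ?inord_val//.
  by rewrite -ltnS.
have mcyl t : measurable (cyl t).
  exact: (@measurable_forall_le n (fun i => Z i @^-1` [set t (inord i)])).
have mX t : measurable (X @^-1` [set t]) by rewrite cylE.
have mA := @measurable_avoids Z v n mZ.
pose b (t : {ffun 'I_n.+1 -> V}) := [forall i, t i != v].
have avoids_cyl t : avoids Z v n `&` cyl t = if b t then cyl t else set0.
  case: ifPn => [/forallP bt|nbt]; apply/seteqP; split=> w //=.
  - by case.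
  - by move=> Zt; split=> // i lin; rewrite Zt//; exact/eqP/bt.
  - move=> [av Zt]; case/negP: nbt; apply/forallP => i; apply/eqP => tv.
    have lin : (i <= n)%N by rewrite -ltnS.
    by apply: (av i) => //; rewrite Zt// inord_val.
rewrite (pr_partition _ mX); last by apply: measurableI => //; exact: mZ.
transitivity (\sum_t (b t)%:R * (pr (cyl t) * walk_step e (t ord_max) y)).
  apply: eq_bigr => t _; rewrite cylE setIAC avoids_cyl.
  case: (b t); last by rewrite set0I /pr measure0 mul0r.
  rewrite mul1r; apply: EFin_inj; rewrite EFinM !prK//; last exact: measurableI.
  have := markov n (fun i => t (inord i)) y.
  rewrite (_ : inord n = ord_max); first by move=> <-.
  by apply: val_inj; rewrite /= inordK.
have qE x : pr (avoids Z v n `&` Z n @^-1` [set x]) =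
    \sum_t (b t)%:R * pr (cyl t) * (t ord_max == x)%:R.
  rewrite (pr_partition _ mX); last by apply: measurableI => //; exact: mZ.
  apply: eq_bigr => t _; rewrite cylE setIAC avoids_cyl.
  case: (b t); last by rewrite set0I /pr measure0 !mul0r.
  rewrite mul1r.
  have cn w : cyl t w -> Z n w = t ord_max.
    move=> /(_ n (leqnn n)) ->; congr (t _); apply: val_inj.
    by rewrite /= inordK.
  case: eqP => tx; last first.
    rewrite mulr0 (_ : _ `&` _ = set0) ?/pr ?measure0//.
    by apply/seteqP; split=> w //= [/cn ->].
  rewrite mulr1; congr pr; apply/seteqP; split=> w /=; first by case.
  by move=> cw; split=> //; rewrite cn.
under [RHS]eq_bigr do rewrite qE mulr_suml.
rewrite exchange_big/=; apply: eq_bigr => t _.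
rewrite (bigD1 (t ord_max))//= big1 => [|x /negPf xt].
  by rewrite eqxx mulr1 addr0 mulrA.
by rewrite eq_sym xt mulr0 mul0r.
Qed.

(** Optional stopping at time [n] for [f (Z t) + t], a martingale until [v] is hit. In the proof
    [q n] is the law at time [n] of the walk killed at [v]; one step lowers the integral of [f]
    against it by its total mass. *)
Lemma avoids_telescope e u Z v (f : V -> R) n : simple_random_walk P e u Z ->
  f v = 0 -> (forall x, x != v -> f x = 1 + \sum_y walk_step e x y * f y) ->
  \sum_(0 <= i < n) pr (avoids Z v i) =
  f u - \sum_x pr (avoids Z v n `&` Z n @^-1` [set x]) * f x.
Proof.
move=> rwZ fv0 fE; have [mZ Z0 _] := rwZ.
pose q n x := pr (avoids Z v n `&` Z n @^-1` [set x]).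
have qv m : q m v = 0.
  rewrite /q (_ : _ `&` _ = set0) ?/pr ?measure0//.
  by apply/seteqP; split=> w //= [/(_ m (leqnn m))].
have mAZ m x k : measurable (avoids Z v m `&` Z k @^-1` [set x]).
  by apply: measurableI; [exact: measurable_avoids|exact: mZ].
elim: n => [|n IH].
  rewrite big_geq//; apply/esym/eqP; rewrite subr_eq0; apply/eqP.
  (* Only the mass at [u] is given; the other masses are nonnegative and sum to 0. *)
  have Z0x x : pr (Z 0 @^-1` [set x]) = (x == u)%:R.
    case: eqP => [->|/eqP xu]; first by rewrite /pr Z0.
    have : \sum_(y | y != u) pr (Z 0 @^-1` [set y]) == 0.
      have := pr_partition measurableT (mZ 0).
      rewrite (bigD1 u)//= setTI /pr probability_setT Z0 => /eqP.
      rewrite addrC -subr_eq subrr eq_sym.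
      by under eq_bigr do rewrite setTI.
    rewrite psumr_eq0 => [|y _]; last exact: pr_ge0.
    by move=> /allP/(_ x); rewrite mem_index_enum xu => /(_ isT)/eqP.
  rewrite (bigD1 u)//= big1 => [|x xu]; last first.
    suff -> : pr (avoids Z v 0 `&` Z 0 @^-1` [set x]) = 0 by rewrite mul0r.
    have := Z0x x; rewrite (negPf xu) mulr0n => Zx0.
    apply/eqP; rewrite eq_le pr_ge0 andbT -[leRHS]Zx0.
    by rewrite -lee_fin !prK// le_measure ?inE.
  rewrite addr0; have [->|uv] := eqVneq u v; first by rewrite fv0 mulr0.
  rewrite (_ : _ `&` _ = Z 0 @^-1` [set u]) ?Z0x ?eqxx ?mul1r//.
  apply/seteqP; split=> w /=; first by case.
  by move=> Zu; split=> // i; rewrite leqn0 => /eqP ->; rewrite Zu; exact/eqP.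
rewrite big_nat_recr//= IH -addrA; congr (_ + _).
have -> : pr (avoids Z v n) = \sum_x q n x.
  exact: pr_partition (measurable_avoids _ _ mZ) (mZ n).
suff -> : \sum_y q n.+1 y * f y = \sum_x q n x * f x - \sum_x q n x.
  by rewrite opprB addrC.
transitivity (\sum_y (\sum_x q n x * walk_step e x y) * f y).
  (* Walks arriving at [v] carry the factor [f v = 0]; for a walk arriving elsewhere, avoiding [v]
     up to time [n] or up to [n.+1] is the same. *)
  apply: eq_bigr => y _; have [->|yv] := eqVneq y v; first by rewrite fv0 !mulr0.
  rewrite -(avoids_step v n y rwZ); congr (pr _ * _); apply/seteqP; split=> w /=.
    by move=> [av Zy]; split=> // i lin; apply: av; exact: leqW.
  move=> [av Zy]; split=> // i; rewrite leq_eqVlt => /orP[/eqP ->|]; last exact: av.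
  by rewrite Zy; exact/eqP.
under eq_bigr do rewrite mulr_suml.
rewrite exchange_big/= -sumrB; apply: eq_bigr => x _.
under eq_bigr do rewrite -mulrA.
rewrite -mulr_sumr; have [->|xv] := eqVneq x v; first by rewrite qv !mul0r subr0.
by rewrite (fE _ xv) mulrDr mulr1 addrAC subrr add0r.
Qed.

(* Boundedness of [f] bounds the partial sums of the tail probabilities, so
   these tend to [0] and kill the remainder of the telescoping sum. *)
Lemma expected_hitting_time_harmonic e u Z v (f : V -> R) :
  simple_random_walk P e u Z ->
  f v = 0 -> (forall x, x != v -> f x = 1 + \sum_y walk_step e x y * f y) ->
  expected_hitting_time P Z v = (f u)%:E.
Proof.
move=> rwZ fv0 fE; have [mZ _ _] := rwZ.
have mA n := @measurable_avoids Z v n mZ.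
rewrite expected_hitting_timeE//.
pose a n := pr (avoids Z v n).
have a0 n : 0 <= a n by exact: pr_ge0.
have aE n : P (avoids Z v n) = (a n)%:E by rewrite prK.
under eq_eseriesr do rewrite aE.
pose rem n := \sum_x pr (avoids Z v n `&` Z n @^-1` [set x]) * f x.
have sumE n : series a n = f u - rem n by exact: avoids_telescope rwZ fv0 fE.
pose B := \sum_x `|f x|.
have remB n : `|rem n| <= a n * B.
  rewrite (le_trans (ler_norm_sum _ _ _))// /a.
  rewrite (pr_partition (mA n) (mZ n)) mulr_suml ler_sum// => x _.
  rewrite normrM ger0_norm ?pr_ge0// ler_wpM2l ?pr_ge0//.
  by rewrite /B (bigD1 x)//= lerDl sumr_ge0.
have a1 n : a n <= 1 by rewrite -lee_fin prK// probability_le1.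
have B0 : 0 <= B by rewrite sumr_ge0.
have ca : cvgn (series a).
  apply: nondecreasing_is_cvgn.
    apply/nondecreasing_seqP => n.
    by rewrite /series/= big_nat_recr//= lerDl.
  exists (f u + B) => _ [n _ <-]; rewrite sumE lerD2l.
  rewrite (le_trans (ler_norm _))// normrN (le_trans (remB n))//.
  by rewrite ler_piMl.
have a_to0 := cvg_series_cvg_0 ca.
have rem_to0 : rem n @[n --> \oo] --> (0 : R).
  apply/norm_cvg0P.
  apply: (@squeeze_cvgr _ _ _ _ (fun=> 0) (fun n => a n * B)).
  - by near=> n; rewrite normr_ge0 remB.
  - exact: cvg_cst.
  - by rewrite -(mul0r B); apply: cvgMl.
have lim_a : series a n @[n --> \oo] --> f u.
  rewrite (_ : series a = fun n => f u - rem n); last exact/funext.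
  by rewrite -[f u in X in _ --> X]subr0; apply: cvgB => //; exact: cvg_cst.
rewrite (_ : (fun n => _) = EFin \o series a); last first.
  by apply/funext => n; rewrite /= -sumEFin.
by rewrite EFin_lim// (cvg_lim _ lim_a).
Unshelve. all: by end_near. Qed.

End hitting_time_of_walk.

(** * The adjacency operator of the circulant graph *)

Lemma Zp_nat_eq0 N m : (1 < N)%N -> (m%:R == 0 :> 'Z_N) = (N %| m)%N.
Proof. by move=> N1; rewrite -val_eqE /= val_Zp_nat. Qed.

Lemma circulantS N k (x y : 'Z_N) :
  circulant k.+1 x y =
  [|| circulant k x y, y == x + k.+1%:R | y == x - k.+1%:R].
Proof.
rewrite /circulant; apply/existsP/idP => [[s /andP[s0 xy]]|].
  have [sk|ks] := ltnP s k.+1.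
    by apply/orP; left; apply/existsP; exists (Ordinal sk); rewrite s0.
  have -> : k.+1 = s by apply/eqP; rewrite eqn_leq ks -ltnS ltn_ord.
  apply/orP; right; case/orP: xy => /eqP xy; apply/orP; [right|left].
    by rewrite -xy opprB addrC subrK.
  by rewrite -[_%:R]opprK -xy opprB addrC subrK.
case/orP => [/existsP[s xy]|xy].
  by exists (widen_ord (leqnSn _) s).
exists ord_max; case/orP: xy => /eqP ->.
  by rewrite opprD addrA subrr add0r eqxx orbT.
by rewrite opprB addrC subrK eqxx.
Qed.

(** A coincidence of [m] with [s] or [- s] modulo [N], where [s <= k], would make [N] divide [m - s]
    or [m + s], which lie strictly between 0 and [N]. *)
Lemma circulant_disjoint N k (x : 'Z_N) m : (k < m)%N -> (k + m < N)%N ->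
  ~~ circulant k x (x + m%:R) && ~~ circulant k x (x - m%:R).
Proof.
move=> km kmN; have N1 : (1 < N)%N by lia.
rewrite -negb_or; apply/negP => /orP H.
have {H} [s /andP[s0 H]] : exists s : 'I_k.+1,
    (0 < s)%N && ((m%:R == s%:R :> 'Z_N) || (m%:R == - s%:R :> 'Z_N)).
  by case: H => /existsP[s /andP[s0 H]]; exists s; rewrite s0; move: H;
    rewrite ?opprD ?opprK addrA subrr add0r // eqr_oppLR eqr_opp orbC.
have sk : (s <= k)%N by rewrite -ltnS.
case/orP: H; last first.
  rewrite -subr_eq0 opprK -natrD Zp_nat_eq0// => /dvdn_leq; lia.
by rewrite -subr_eq0 -natrB ?Zp_nat_eq0//; [move=> /dvdn_leq; lia|lia].
Qed.

(** The bound [2 * k < N] keeps the [2 * k] shifts distinct modulo [N], so no neighbour is counted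
    twice. *)
Lemma sum_circulant (F : nzRingType) N k (f : 'Z_N -> F) x : (2 * k < N)%N ->
  \sum_(y | circulant k x y) f y =
  \sum_(1 <= s < k.+1) (f (x + s%:R) + f (x - s%:R)).
Proof.
elim: k => [|k IH] kN.
  rewrite big_geq// big1// => y /existsP[s].
  by rewrite ord1.
have N1 : (1 < N)%N by lia.
have /andP[Dp Dm] := @circulant_disjoint N k x k.+1 (leqnn _) ltac:(lia).
rewrite big_nat_recr//= -IH; last by lia.
rewrite (bigID (circulant k x))/=; congr (_ + _).
  by apply: eq_bigl => y; rewrite circulantS; case: circulant; rewrite ?andbF.
have pm : x + k.+1%:R != x - k.+1%:R.
  rewrite -subr_eq0 opprB addrC addrA subrK -natrD Zp_nat_eq0//.
  by apply/negP => /dvdn_leq; lia.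
rewrite (bigD1 (x + k.+1%:R)) /=; last by rewrite circulantS eqxx Dp orbT.
rewrite (bigD1 (x - k.+1%:R)) /=; last first.
  by rewrite circulantS eqxx Dm eq_sym pm !orbT.
rewrite big1 ?addr0// => y; rewrite circulantS.
by case: circulant => //=; case: eqP => //=; case: eqP.
Qed.

Section circulant_matrix.
Variables (F : fieldType) (N : nat).

(** The dimension is that of the ordinal type underlying ['Z_N], so residues serve as indices and
    [i + s] is addition modulo [N]. *)
Definition shift_mx (s : 'Z_N) : 'M[F]_((Zp_trunc N).+2) :=
  \matrix_(i, j) (j == i + s)%:R.

(** Operator analogue of [2 cos (s t)]; [cosine_mxM] is the product-to-sum formula. *)
Definition cosine_mx (s : 'Z_N) := shift_mx s + shift_mx (- s).

Lemma mul_shift_mx m s (A : 'M[F]_((Zp_trunc N).+2, m)) i j :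
  (shift_mx s *m A) i j = A (i + s) j.
Proof.
rewrite mxE (bigD1 (i + s))//= mxE eqxx mul1r big1 ?addr0// => t /negPf ti.
by rewrite mxE ti mul0r.
Qed.

Lemma mul_cosine_mx m s (A : 'M[F]_((Zp_trunc N).+2, m)) i j :
  (cosine_mx s *m A) i j = A (i + s) j + A (i - s) j.
Proof. by rewrite mulmxDl mxE !mul_shift_mx. Qed.

Lemma cosine_mx0 : cosine_mx 0 = 2.
Proof.
apply/matrixP => i j; by rewrite /cosine_mx oppr0 -mulr2n !mxE addr0 eq_sym.
Qed.

Lemma cosine_mxM s t : cosine_mx s * cosine_mx t = cosine_mx (s + t) + cosine_mx (t - s).
Proof.
apply/matrixP => i j; rewrite mul_cosine_mx !mxE.
have -> : i + s - t = i - (t - s) by ring.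
have -> : i - s + t = i + (t - s) by ring.
have -> : i - s - t = i - (s + t) by ring.
by rewrite !addrA; ring.
Qed.

(** Operator form of [T_s (cos t) = cos (s t)]: the product-to-sum formula gives the matrices
    [cosine_mx s] the Chebyshev recurrence, hence an induction on two consecutive indices. *)
Lemma horner_chebyshevT s (h2 : 2 != 0 :> F) :
  horner_mx (cosine_mx 1) (chebyshevT F s \Po (2^-1 *: 'X)) =
  2^-1 *: cosine_mx s%:R.
Proof.
suff [] : horner_mx (cosine_mx 1) (chebyshevT F s \Po (2^-1 *: 'X)) =
  2^-1 *: cosine_mx s%:R /\
  horner_mx (cosine_mx 1) (chebyshevT F s.+1 \Po (2^-1 *: 'X)) =
  2^-1 *: cosine_mx s.+1%:R by [].
elim: s => [|s [IH0 IH1]].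
  rewrite chebyshevT0 chebyshevT1 comp_polyC comp_polyX cosine_mx0.
  rewrite linearZ/= horner_mx_C horner_mx_X; split=> //.
  by rewrite -[2 in RHS]/(1 *+ 2) -scaler_nat scalerA mulVf// scale1r.
split=> //.
rewrite chebyshevTSS mulr2n comp_polyB comp_polyD comp_polyM comp_polyX.
rewrite rmorphB rmorphD rmorphM/= linearZ/= horner_mx_X IH0 IH1.
have -> : s.+2%:R = 1 + s.+1%:R :> 'Z_N by rewrite -natr1 addrC.
have -> : s%:R = s.+1%:R - 1 :> 'Z_N by rewrite -natr1 addrK.
rewrite -scalerAl -scalerAr cosine_mxM; apply/matrixP => i j.
rewrite !mxE; field.
by rewrite h2.
Qed.

End circulant_matrix.

(** * Green functions on the circulant graph *)

Lemma size_chebyshevT (F : nzRingType) s : (size (chebyshevT F s) <= s.+1)%N.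
Proof.
suff [] : (size (chebyshevT F s) <= s.+1)%N /\
  (size (chebyshevT F s.+1) <= s.+2)%N by [].
elim: s => [|s [IH0 IH1]].
  by rewrite chebyshevT0 chebyshevT1 size_poly1 size_polyX.
split=> //; rewrite chebyshevTSS (leq_trans (size_polyD _ _))// geq_max size_polyN.
apply/andP; split; last by rewrite (leq_trans IH0)// leqW.
rewrite mulr2n (leq_trans (size_polyD _ _))// maxnn.
by rewrite (leq_trans (size_polyMleq _ _))// size_polyX.
Qed.

Section green_function.
Variable F : numFieldType.
Implicit Types (nu : F) (N k : nat).

Lemma horner_chebyshevT_joukowski (z : F) s : z != 0 ->
  (chebyshevT F s \Po (2^-1 *: 'X)).[z + z^-1] = (z ^+ s + z ^- s) / 2.
Proof.
move=> z0; rewrite horner_comp hornerZ hornerX.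
suff [] : (chebyshevT F s).[2^-1 * (z + z^-1)] = (z ^+ s + z ^- s) / 2 /\
  (chebyshevT F s.+1).[2^-1 * (z + z^-1)] = (z ^+ s.+1 + z ^- s.+1) / 2 by [].
elim: s => [|s [IH0 IH1]].
  rewrite chebyshevT0 chebyshevT1 hornerC hornerX !expr0 !expr1 invr1.
  by split; field.
split=> //; rewrite chebyshevTSS hornerD hornerN hornerMn hornerM hornerX IH0 IH1.
have zs0 : z ^+ s != 0 by rewrite expf_neq0.
by rewrite !exprS; field; rewrite z0 zs0.
Qed.

(* On the unit circle the cosine sum is at most [k], hence [D >= nu / 2]. *)
Lemma polyD_joukowski_neq0 k nu (z : F) : 0 < nu -> `|z| = 1 ->
  (polyD k nu).[z + z^-1] != 0.
Proof.
move=> nu0 z1; have z0 : z != 0 by rewrite -normr_eq0 z1 oner_eq0.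
rewrite /polyD hornerD hornerN hornerC horner_sum subr_eq0; apply/negP => /eqP H.
have : `|k%:R + nu / 2| <= k%:R.
  rewrite H (le_trans (ler_norm_sum _ _ _))//.
  have -> : (k%:R : F) = \sum_(1 <= s < k.+1) 1.
    by rewrite big_const_nat iter_addr_0 subn1.
  apply: ler_sum => s _; rewrite horner_chebyshevT_joukowski// normrM.
  rewrite normfV normr_nat ler_pdivrMr// mul1r.
  rewrite (le_trans (ler_normD _ _))// normfV normrX z1 expr1n invr1.
  by rewrite -mulr2n.
rewrite ger0_norm; last by rewrite addr_ge0 ?ler0n ?divr_ge0 ?ler0n ?ltW.
by rewrite gerDl lt_geF ?divr_gt0 ?ltr0n.
Qed.

Lemma size_polyD_le k nu : (size (polyD k nu) <= k.+1)%N.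
Proof.
rewrite (leq_trans (size_polyD _ _))// geq_max size_polyN.
rewrite (leq_trans (size_polyC_leq1 _))//=.
rewrite big_nat; elim/big_ind: _ => [|p q Hp Hq|s /andP[_ sk]].
- by rewrite size_poly0.
- by rewrite (leq_trans (size_polyD _ _))// geq_max Hp.
rewrite (leq_trans (size_comp_poly_leq _ _))//.
rewrite (leq_ltn_trans _ sk)//.
have : (size (2^-1 *: 'X : {poly F})) = 2 by rewrite size_scale ?size_polyX ?invr_eq0.
move=> ->; rewrite muln1.
by have := size_chebyshevT F s; case: size.
Qed.

(** The expansion of [1 / p] multiplied by [p], proved by Lagrange interpolation: [Q c] vanishes at
    the other roots and equals the derivative of [p] at [phi c], so both sides have degree below [k]
    and agree at [k] distinct points. *)
Lemma partial_fractions k (p : {poly F}) (phi : 'I_k -> F) (Q : 'I_k -> {poly F}) :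
  (0 < k)%N -> p != 0 -> (size p <= k.+1)%N -> injective phi ->
  (forall c, p = Q c * ('X - (phi c)%:P)) ->
  \sum_c (p^`().[phi c])^-1 *: Q c = 1.
Proof.
move=> k0 p0 sp inj pE.
have vanish (q : {poly F}) : (size q <= k)%N -> (forall c, q.[phi c] = 0) -> q = 0.
  move=> sq qphi; apply: (@roots_geq_poly_eq0 _ _ [seq phi c | c : 'I_k]).
  - by apply/allP => z /mapP[c _ ->]; apply/rootP.
  - by rewrite map_inj_uniq ?enum_uniq.
  - by rewrite size_map size_enum_ord.
have sQ c : (size (Q c) <= k)%N.
  have Q0 : Q c != 0 by apply: contraNneq p0 => Q0; rewrite (pE c) Q0 mul0r.
  move: sp; rewrite (pE c) size_Mmonic ?monicXsubC// size_XsubC addn2 //.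
have Qphi c d : d != c -> (Q c).[phi d] = 0.
  move=> dc; have : p.[phi d] = 0 by rewrite (pE d) !hornerE subrr mulr0.
  rewrite (pE c) hornerM hornerXsubC => /eqP; rewrite mulf_eq0 subr_eq0.
  by rewrite (inj_eq inj) (negPf dc) orbF => /eqP.
have p'E c : p^`().[phi c] = (Q c).[phi c].
  by rewrite {1}(pE c) derivM derivXsubC mulr1 !hornerE subrr mulr0 add0r.
(* If [Q c] also vanished at [phi c], it would have [k] distinct roots and degree below [k], forcing
   [p = 0]. *)
have Qc0 c : (Q c).[phi c] != 0.
  apply: contraNneq p0 => Qc; rewrite (pE c) (vanish (Q c)) ?mul0r// => d.
  by have [->//|dc] := eqVneq d c; exact: Qphi.
apply/eqP; rewrite -subr_eq0; apply/eqP/vanish => [|d].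
  rewrite (leq_trans (size_polyD _ _))// geq_max size_polyN size_poly1 k0 andbT.
  rewrite (leq_trans (size_sum _ _ _))//; apply/bigmax_leqP => c _.
  by rewrite (leq_trans (size_scale_leq _ _)).
rewrite hornerD hornerN hornerC horner_sum (bigD1 d)//= big1 => [|c cd].
  by rewrite hornerZ p'E mulVf// addr0 subrr.
by rewrite hornerZ Qphi ?mulr0// eq_sym.
Qed.

(** For [|rho| < 1] this is the sum over the integers congruent to [x] modulo [N] of the resolvent
    [rho ^ |x| / (rho - rho^-1)] of the integer line. The exponents use the representative of [x] in
    [[0, N)]. *)
Definition cycle_resolvent N (rho : F) (x : 'Z_N) : F :=
  (rho ^+ x + rho ^+ (N - x)) / ((rho - rho^-1) * (1 - rho ^+ N)).

(** The case [m = N], whose residue is 0, holds because the formula is symmetric under [m -> N - m];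
    it absorbs the wrap-around at the end of the cycle. *)
Lemma cycle_resolvent_nat N (rho : F) m : (1 < N)%N -> (m <= N)%N ->
  cycle_resolvent rho (m%:R : 'Z_N) =
  (rho ^+ m + rho ^+ (N - m)) / ((rho - rho^-1) * (1 - rho ^+ N)).
Proof.
move=> N1 mN; rewrite /cycle_resolvent val_Zp_nat//.
have [->|mN'] := eqVneq m N; last by rewrite modn_small// ltn_neqAle mN'.
by rewrite modnn subn0 subnn addrC.
Qed.

(** Both [rho ^ x] and [rho ^ (N - x)] solve the homogeneous recurrence. Only the wrap-around at 0
    breaks it, and the denominator normalises that jump to 1. *)
Lemma cycle_resolventP N (rho : F) (x : 'Z_N) : (1 < N)%N ->
  rho != 0 -> rho ^+ 2 != 1 -> rho ^+ N != 1 ->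
  cycle_resolvent rho (x + 1) + cycle_resolvent rho (x - 1)
    - (rho + rho^-1) * cycle_resolvent rho x = (x == 0)%:R.
Proof.
move=> N1 rho0 rho2 rhoN.
have d0 : rho * rho - 1 != 0 by rewrite subr_eq0 -expr2.
have dN : 1 - rho ^+ N != 0 by rewrite subr_eq0 eq_sym.
have xN : (x < N)%N by rewrite -[X in (_ < X)%N](Zp_cast N1).
rewrite -[x]natr_Zp Zp_nat_eq0//.
case: (nat_of_ord x) xN => [|m] mN.
  rewrite add0r dvdn0 sub0r.
  have -> : - 1 = (N.-1)%:R :> 'Z_N.
    apply/eqP; rewrite eq_sym -subr_eq0 opprK natr1 prednK ?Zp_nat_eq0//; lia.
  rewrite -[1 : 'Z_N]/(1%:R) !cycle_resolvent_nat//; try lia.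
  have -> : (N - N.-1 = 1)%N by lia.
  have -> : (N - 1 = N.-1)%N by lia.
  have eN : rho ^+ N = rho * rho ^+ N.-1 by rewrite -exprS prednK// ltnW.
  rewrite eN in dN; rewrite subn0 expr0 expr1 eN.
  rewrite mulr1n. by field; rewrite rho0 d0 dN.
have -> : (N %| m.+1)%N = false by apply/negP => /dvdn_leq; lia.
rewrite natr1 -[m.+1%:R - 1](_ : m%:R = _); last by rewrite -natr1 addrK.
rewrite !cycle_resolvent_nat//; try lia.
have -> : (N - m = (N - m.+2).+2)%N by lia.
have -> : (N - m.+1 = (N - m.+2).+1)%N by lia.
rewrite mulr0n !exprS. by field; rewrite rho0 d0 dN.
Qed.

(** Binet formula: [eta] and [eta^-1] are the characteristic roots of the recurrence, distinct
    because [eta ^+ 2 != 1]. *)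
Lemma lucasV_joukowski (eta : F) n : eta != 0 -> eta ^+ 2 != 1 ->
  lucasV (eta + eta^-1) n = (eta ^+ n - eta ^- n) / (eta - eta^-1).
Proof.
move=> eta0 eta2; have d0 : eta * eta - 1 != 0 by rewrite subr_eq0 -expr2.
suff [] : lucasV (eta + eta^-1) n = (eta ^+ n - eta ^- n) / (eta - eta^-1) /\
  lucasV (eta + eta^-1) n.+1 = (eta ^+ n.+1 - eta ^- n.+1) / (eta - eta^-1) by [].
elim: n => [|n [IH0 IH1]].
  rewrite lucasV0 lucasV1 expr0 expr1 invr1 subrr mul0r; split=> //.
  by rewrite divff//; apply: contraNneq d0 => H; rewrite -[1](mulfV eta0) -mulrBr H mulr0.
split=> //; rewrite lucasVSS IH0 IH1 !exprS.
have e0 : eta ^+ n != 0 by rewrite expf_neq0.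
by field; rewrite eta0 d0 e0.
Qed.

(** With [p = eta ^+ l] and [q = eta ^+ (N - l)], the difference of the numerators is [p^2 + q^2 - 1
    - p^2 q^2 = - (1 - p^2) (1 - q^2)], and by the Binet formula its factors yield the two terms of
    the product. *)
Lemma cycle_resolvent_lucasV N (eta : F) l : (1 < N)%N -> (l <= N)%N ->
  eta != 0 -> (eta ^+ 2) ^+ 2 != 1 -> (eta ^+ 2) ^+ N != 1 ->
  cycle_resolvent (eta ^+ 2) (- l%:R : 'Z_N) - cycle_resolvent (eta ^+ 2) (0 : 'Z_N) =
  1 / (eta + eta^-1) *
  (lucasV (eta + eta^-1) l * lucasV (eta + eta^-1) (N - l)
     / lucasV (eta + eta^-1) N).
Proof.
move=> N1 lN eta0 eta4 etaN.
have eta2 : eta ^+ 2 != 1 by apply: contraNneq eta4 => ->; rewrite expr1n.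
have -> : - l%:R = (N - l)%:R :> 'Z_N by rewrite natrB// pchar_Zp// sub0r.
rewrite -[0 : 'Z_N]/(0%:R) !cycle_resolvent_nat ?leq_subr// subKn// subn0.
rewrite !lucasV_joukowski// -!exprM ![(2 * _)%N]mulnC !exprM.
have lNE : eta ^+ N = eta ^+ l * eta ^+ (N - l) by rewrite -exprD subnKC.
rewrite -exprM mulnC exprM lNE in etaN; rewrite lNE expr0.
have a0 : eta ^+ l != 0 by rewrite expf_neq0.
have b0 : eta ^+ (N - l) != 0 by rewrite expf_neq0.
move: (eta ^+ l) (eta ^+ (N - l)) a0 b0 etaN => p q p0 q0 pq.
have d1 : eta * eta - 1 != 0 by rewrite subr_eq0 -expr2.
(* This is [eta] times [eta + eta^-1], so the denominator [gamma] is nonzero. *)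
have d2 : eta * eta + 1 != 0.
  apply: contraNneq eta4 => /eqP; rewrite addr_eq0 -expr2 => /eqP ->.
  by rewrite sqrrN expr1n.
have d3 : p * q * (p * q) - 1 != 0 by rewrite subr_eq0 -expr2.
field; rewrite eta0 d1 q0 p0 d3 d2 /= !subr_eq0 -expr2 eta4 andbT.
by rewrite eq_sym.
Qed.

Lemma horner_polyD_cosine_mx N k nu (w : 'cV[F]_((Zp_trunc N).+2)) x :
  (2 * k < N)%N ->
  (horner_mx (cosine_mx F (1 : 'Z_N)) (polyD k nu) *m w) x 0 *+ 2 =
  (2 * k%:R + nu) * w x 0 - \sum_(y | circulant k x y) w y 0.
Proof.
move=> kN; rewrite sum_circulant// rmorphB/= horner_mx_C raddf_sum/= mulmxBl.
rewrite mul_scalar_mx mulmx_suml !mxE summxE mulrnBl.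
congr (_ - _); first by rewrite -mulr_natl; field.
rewrite -sumrMnl; apply: eq_bigr => s _.
rewrite horner_chebyshevT ?pnatr_eq0// -scalemxAl mxE mul_cosine_mx.
by field.
Qed.

Lemma circulant_green N k nu (phi rho eta : 'I_k -> F) :
  (0 < k)%N -> (2 * k < N)%N -> 0 < nu -> root_choice nu phi rho eta ->
  exists g : 'Z_N -> F,
    (forall x, (2 * k%:R + nu) * g x - \sum_(y | circulant k x y) g y = (x == 0)%:R)
    /\ (forall l, (l <= N)%N -> g (- l%:R) - g 0 = rootA nu phi eta N l / 2).
Proof.
move=> k0 kN nu0 [inj roots rhoE etaE].
have N1 : (1 < N)%N by lia.
pose D := polyD k nu; pose M := cosine_mx F (1 : 'Z_N).
have D0 : D != 0.
  apply/negP => /eqP D0; have := @polyD_joukowski_neq0 k nu 1 nu0 (normr1 _).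
  by rewrite -/D D0 horner0 eqxx.
have Dphi c : root D (phi c) by apply/roots; exists c.
(* [D] has no root [z + z^-1] with [z] on the unit circle. Hence no positive power of [rho c] is 1,
   and the denominators of the resolvents do not vanish. *)
have rho_norm c : `|rho c| != 1.
  apply/negP => /eqP /(@polyD_joukowski_neq0 k nu _ nu0).
  by have [_ ->] := rhoE c; have /rootP-> := Dphi c; rewrite eqxx.
have rhoX c m : (0 < m)%N -> rho c ^+ m != 1.
  move=> m0; apply: contra_neq (rho_norm c) => /(congr1 Num.norm).
  by rewrite normrX normr1 => /eqP; rewrite pexpr_eq1// => /eqP.
have DQ c : D = (D %/ ('X - (phi c)%:P)) * ('X - (phi c)%:P).
  by rewrite divpK// dvdp_XsubCl.
have PF := partial_fractions k0 D0 (size_polyD_le k nu) inj DQ.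
pose a c := (D^`().[phi c])^-1; pose r c := @cycle_resolvent N (rho c).
pose v c : 'cV[F]_((Zp_trunc N).+2) := \col_x r c x.
pose delta : 'cV[F]_((Zp_trunc N).+2) := \col_x (x == 0)%:R.
have vP c : horner_mx M ('X - (phi c)%:P) *m v c = delta.
  have [rho0 phiE] := rhoE c.
  rewrite rmorphB/= horner_mx_X horner_mx_C; apply/matrixP => i j.
  rewrite mulmxBl mul_scalar_mx [LHS]mxE mul_cosine_mx !mxE -phiE.
  by apply: cycle_resolventP; rewrite ?rhoX// ltnW.
(* Since [M - phi c] sends [v c] to [delta], [D(M)] sends it to the cofactor of [M - phi c] applied
   to [delta]; the weighted cofactors sum to 1. *)
have DM : horner_mx M D *m (\sum_c a c *: v c) = delta.
  rewrite mulmx_sumr.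
  transitivity (horner_mx M (\sum_c a c *: (D %/ ('X - (phi c)%:P))) *m delta).
    rewrite raddf_sum/= mulmx_suml; apply: eq_bigr => c _.
    rewrite -scalemxAr {1}(DQ c) rmorphM/= -mulmxE -mulmxA vP.
    by rewrite linearZ/= -scalemxAl.
  by rewrite PF rmorph1 mul1mx.
(* The division by 2 compensates the factor in [L + nu = 2 D(M)]. *)
exists (fun x => (\sum_c a c * r c x) / 2); split=> [x|l lN].
  pose W := \sum_c a c *: v c.
  have H := @horner_polyD_cosine_mx N k nu W x kN.
  rewrite -/M -/D DM in H.
  have wE y : W y 0 = \sum_c a c * r c y.
    by rewrite summxE; apply: eq_bigr => c _; rewrite !mxE.
  have -> : \sum_(y | circulant k x y) (\sum_c a c * r c y) / 2 =
            (\sum_(y | circulant k x y) W y 0) / 2.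
    by rewrite mulr_suml; apply: eq_bigr => y _; rewrite wE.
  by rewrite -wE mulrA -mulrBl -H mxE; field.
rewrite -mulrBl; congr (_ / _); rewrite -sumrB; apply: eq_bigr => c _.
rewrite -mulrBr /r etaE cycle_resolvent_lucasV//; last 3 first.
- have [+ _] := rhoE c; rewrite etaE; apply: contraNneq => ->.
  by rewrite expr0n.
- by rewrite -etaE rhoX.
- by rewrite -etaE rhoX// ltnW.
by rewrite /a /D /gamma !mulrA; congr (_ * _ * _ * _); rewrite invfM mulr1 mul1r mulrC.
Qed.

End green_function.

(** * The product with the Petersen graph *)

(** The common neighbours are the 2-subsets of the complement of the union. *)
Lemma card_petersen_common (A B : petersen_vertex) :
  #|[set C | petersen A C && petersen B C]| =
  'C(5 - #|val A :|: val B|, 2).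
Proof.
rewrite -(card_imset _ val_inj).
have -> : (5 - #|val A :|: val B|)%N = #|~: (val A :|: val B)|.
  by rewrite [in RHS]cardsCs finset.setCK card_ord.
rewrite -cards_draws; congr #|pred_of_set _|; apply/setP => S.
rewrite inE finset.setCU finset.subsetI -!finset.disjoints_subset; apply/imsetP/andP.
  move=> [C]; rewrite inE /petersen => /andP[AC BC ->].
  by rewrite ![[disjoint val C & _]]disjoint_sym AC BC; split=> //; exact: (valP C).
move=> [/andP[SA SB] S2]; exists (Sub S S2 : petersen_vertex) => //.
by rewrite inE /petersen SubK ![[disjoint _ & S]]disjoint_sym SA.
Qed.

(** Strong regularity with parameters (10, 3, 0, 1): the union has 2, 4 or 3 elements according as
    the pairs are equal, disjoint or meet in one point, and the binomials are 3, 0 and 1. *)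
Lemma petersen_srg (A B : petersen_vertex) :
  #|[set C | petersen A C && petersen B C]| =
  if A == B then 3%N else ~~ petersen A B :> nat.
Proof.
rewrite card_petersen_common cardsU.
have A2 : #|val A| = 2 by exact/eqP/(valP A).
have B2 : #|val B| = 2 by exact/eqP/(valP B).
rewrite A2 B2; case: (eqVneq A B) => [<-|AB]; first by rewrite finset.setIid A2.
rewrite /petersen -setI_eq0; have [->|AB0] := eqVneq (val A :&: val B) finset.set0.
  by rewrite cards0.
have -> : #|val A :&: val B| = 1%N; last by [].
apply/eqP; rewrite eqn_leq card_gt0 AB0 andbT leqNgt; apply/negP => AB2.
move/eqP: AB; apply; apply: val_inj.
have -> : val A = val A :&: val B.
  by apply/eqP; rewrite eq_sym eqEcard finset.subsetIl A2.
by apply/eqP; rewrite eqEcard finset.subsetIr B2.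
Qed.

Lemma card_petersen_nbr (A : petersen_vertex) : #|[set C | petersen A C]| = 3%N.
Proof.
have := petersen_srg A A; rewrite eqxx => <-.
by apply: eq_card => C; rewrite !inE andbb.
Qed.

Section product_potential.
Variable F : numFieldType.

(** The values at distance 0, 1, 2 from [a]. The graph has diameter 2, so every function of the
    distance has this form, in particular the spectral projections applied to the unit mass at
    [a]. *)
Definition distance_fun (p q s : F) (a b : petersen_vertex) : F :=
  if b == a then p else if petersen a b then q else s.

Lemma sum_distance_fun p q s a b :
  \sum_(c | petersen b c) distance_fun p q s a c =
  if b == a then 3 * q else if petersen a b then p + 2 * s else q + 2 * s.
Proof.
(* In the basis of the constant, the unit mass at [a] and the adjacency to [a], the sum reduces to
   the degree, the adjacency of [a] and [b], and their number of common neighbours. *)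
transitivity (\sum_(c | petersen b c)
    (s + (c == a)%:R * (p - s) + (petersen a c)%:R * (q - s))).
  apply: eq_bigr => c _; rewrite /distance_fun.
  by case: eqP => [->|_]; [rewrite petersen_irr|case: petersen];
    rewrite ?mulr1n ?mulr0n; ring.
rewrite !big_split/= -!mulr_suml sumr_const.
have -> : #|[pred c | petersen b c]| = 3%N.
  by rewrite -(card_petersen_nbr b); apply: eq_card => c; rewrite !inE.
have -> : \sum_(c | petersen b c) (c == a)%:R = (petersen a b)%:R :> F.
  rewrite (petersen_sym a b); case: (boolP (petersen b a)) => ba.
    rewrite (bigD1 a)//= eqxx big1 ?addr0// => c /andP[_ /negPf ca].
    by rewrite ca.
  rewrite big1// => c bc; case: eqP => // ca.
  by rewrite -ca bc in ba.
have -> : \sum_(c | petersen b c) (petersen a c)%:R =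
    (if b == a then 3%N else ~~ petersen b a : nat)%:R :> F.
  by rewrite -petersen_srg -natr_sum -sum1dep_card big_mkcondr; congr _%:R.
rewrite (petersen_sym b a); case: eqP => [->|_].
  by rewrite petersen_irr mulr0n; ring.
by case: petersen; rewrite /= ?mulr1n ?mulr0n; ring.
Qed.

Lemma sum_cartesian_product (V W : finType) (e : rel V) (f : rel W)
    (g : V * W -> F) x b : irreflexive e -> irreflexive f ->
  \sum_(q | cartesian_product e f (x, b) q) g q =
  \sum_(y | e x y) g (y, b) + \sum_(c | f b c) g (x, c).
Proof.
move=> ei fi; rewrite /cartesian_product.
rewrite (bigID (fun q : V * W => q.2 == b))/=; congr (_ + _).
  rewrite (reindex_onto (fun y => (y, b)) fst)/= => [|[y c] /andP[_ /eqP/= ->]//].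
  apply: eq_bigl => y; rewrite !eqxx/= andbT.
  by case: eqP => [->|]; rewrite ?fi ?andbF ?orbF ?andbT//= ei.
rewrite (reindex_onto (fun c => (x, c)) snd)/= => [|[y c]].
  apply: eq_bigl => c; rewrite !eqxx/= ei andbF/= andbT.
  by case: eqP => [->|]; rewrite ?fi ?andbF ?andbT.
by move=> /andP[/orP[/andP[/eqP/= ->]|/andP[/eqP/= -> _ _]//]]; rewrite eqxx.
Qed.

Lemma product_potential N k (h g2 g5 : 'Z_N -> F) (l : 'Z_N) (a : petersen_vertex) :
  (0 < k)%N -> (2 * k < N)%N -> h l = 0 ->
  (forall x, 2 * k%:R * h x - \sum_(y | circulant k x y) h y =
             2 * k%:R - 2 * k%:R * N%:R * (x == l)%:R) ->
  (forall x, (2 * k%:R + 2) * g2 x - \sum_(y | circulant k x y) g2 y = (x == 0)%:R) ->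
  (forall x, (2 * k%:R + 5) * g5 x - \sum_(y | circulant k x y) g5 y = (x == 0)%:R) ->
  exists H : 'Z_N * petersen_vertex -> F,
    [/\ H (l, a) = 0,
      forall p, p != (l, a) -> (2 * k%:R + 3) * H p
        - \sum_(q | cartesian_product (@circulant N k) petersen p q) H q =
        2 * k%:R + 3 &
      H (0, a) = (2 * k%:R + 3) / (2 * k%:R) * h 0
        - N%:R * (2 * k%:R + 3) * (5 * (g2 (- l) - g2 0) + 4 * (g5 (- l) - g5 0))].
Proof.
move=> k0 kN hl hP g2P g5P.
have k0' : k%:R != 0 :> F by rewrite pnatr_eq0 -lt0n.
(* Kernels of the spectral projections of the Petersen graph: values at
   distance 0, 1, 2 from [a] for the Laplace eigenvalues 2 and 5. *)
pose E2 := distance_fun 2^-1 6^-1 (- 6^-1) a.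
pose E5 := distance_fun (2 / 5) (- (4 / 15)) 15^-1 a.
pose d : F := 2 * k%:R + 3.
(* The product Laplacian should send [H] to [d] minus [10 N d] times the unit mass at [(l, a)], as
   its values over the [10 N] vertices must sum to 0. The unit mass at [a] is [1/10 + E2 + E5]: [h]
   supplies the part [1/10], and [g2], [g5] the other two. The constants with [g2 0] and [g5 0] make
   [H] vanish at [(l, a)]. The factors 5 and 4 are [10 / 2] and [10 * 2 / 5]. *)
pose H (p : 'Z_N * petersen_vertex) := d / (2 * k%:R) * h p.1 +
  10 * N%:R * d * (g2 0 / 2 - g2 (p.1 - l) * E2 p.2 +
    (g5 0 * (2 / 5) - g5 (p.1 - l) * E5 p.2)).
have shift (g : 'Z_N -> F) x : \sum_(y | circulant k x y) g (y - l) =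
    \sum_(y | circulant k (x - l) y) g y.
  by rewrite !sum_circulant//; apply: eq_bigr => s _; rewrite addrAC [x - _ - _]addrAC.
have count (z : F) x : \sum_(y | @circulant N k x y) z = 2 * k%:R * z.
  rewrite sum_circulant//= sumr_const_nat subn1/=; ring.
have countP (z : F) b : \sum_(c | petersen b c) z = 3 * z.
  have /(congr1 (fun n => z *+ n)) := card_petersen_nbr b.
  by rewrite -sumr_const big_set/= => ->; rewrite mulr_natl.
exists H; split.
- rewrite /H/= hl /E2 /E5 /distance_fun eqxx subrr; ring.
- move=> [x b] xb; rewrite sum_cartesian_product/=; last 2 first.
  + by apply: circulant_irr; lia.
  + exact: petersen_irr.
  rewrite /H/= !big_split/= -!mulr_sumr !big_split/= !sumrN -!mulr_suml !shift.
  rewrite !count !countP -!mulr_sumr !sum_distance_fun.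
  have -> : \sum_(y | circulant k x y) h y =
      2 * k%:R * h x - (2 * k%:R - 2 * k%:R * N%:R * (x == l)%:R).
    by rewrite -hP; ring.
  have -> : \sum_(y | circulant k (x - l) y) g2 y =
      (2 * k%:R + 2) * g2 (x - l) - (x == l)%:R.
    by rewrite -(subr_eq0 x) -g2P; ring.
  have -> : \sum_(y | circulant k (x - l) y) g5 y =
      (2 * k%:R + 5) * g5 (x - l) - (x == l)%:R.
    by rewrite -(subr_eq0 x) -g5P; ring.
  (* On the fibre [x = l] the defect is proportional to [1/10 + E2 + E5], which vanishes off [a]. *)
  have xb' : ~~ ((x == l) && (b == a)) by [].
  rewrite /E2 /E5 /distance_fun /d; case: (x == l) xb' => /= [/negPf ->|_].
    by case: petersen; rewrite mulr1n; field.
  by case: (b == a); [|case: petersen]; rewrite mulr0n; field.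
- rewrite /H/= sub0r /E2 /E5 /distance_fun eqxx -/d.
  by field.
Qed.

End product_potential.

(** * Regular graphs and the maximum principle *)

Section regular_walk.
Context {d : measure_display} {T : measurableType d} {R : realType}.
Variables (P : probability T R) (V : finType).
Implicit Types (e : rel V) (Z : nat -> T -> V).

Lemma expected_hitting_time_regular e m u Z v (f : V -> R) :
  (0 < m)%N -> (forall x, #|[set y | e x y]%SET| = m) ->
  simple_random_walk P e u Z ->
  f v = 0 -> (forall x, x != v -> f x *+ m - \sum_(y | e x y) f y = m%:R) ->
  expected_hitting_time P Z v = (f u)%:E.
Proof.
move=> m0 em rwZ fv0 fE; apply: expected_hitting_time_harmonic rwZ fv0 _ => x xv.
have m0' : m%:R != 0 :> R by rewrite pnatr_eq0 -lt0n.
have -> : \sum_y walk_step e x y * f y = (\sum_(y | e x y) f y) / m%:R.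
  rewrite [in RHS]big_mkcond mulr_suml; apply: eq_bigr => y _; rewrite /walk_step em.
  by case: (e x y); rewrite ?mul0r// mul1r mulrC.
apply: (mulIf m0'); rewrite mulrDl mul1r mulfVK// mulr_natr.
by apply/eqP; rewrite -subr_eq fE.
Qed.

(* [Re f] and [Re f + Im f] both solve the real system, so [Im (f u) = 0]. *)
Lemma expected_hitting_time_regularC e m u Z v (f : V -> R[i]) :
  (0 < m)%N -> (forall x, #|[set y | e x y]%SET| = m) ->
  simple_random_walk P e u Z ->
  f v = 0 -> (forall x, x != v -> f x *+ m - \sum_(y | e x y) f y = m%:R) ->
  expected_hitting_time P Z v \is a fin_num /\
  (fine (expected_hitting_time P Z v))%:C = f u.
Proof.
move=> m0 em rwZ fv0 fE.
have ReD : {morph @complex.Re R : x y / x + y} by case=> ? ? [].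
have ImD : {morph @complex.Im R : x y / x + y} by case=> ? ? [].
(* The system has integer coefficients, so any additive map fixing 1 carries a complex solution to a
   real one. *)
have solve (g : R[i] -> R) : {morph g : x y / x + y} -> g 0 = 0 -> g 1 = 1 ->
    expected_hitting_time P Z v = (g (f u))%:E.
  move=> gD g0 g1; have gMn x n : g (x *+ n) = g x *+ n.
    by elim: n => [//|n IH]; rewrite !mulrS gD IH.
  have gN x : g (- x) = - g x.
    by apply/eqP; rewrite -addr_eq0 -gD addNr g0.
  apply: (expected_hitting_time_regular (f := g \o f) m0 em rwZ) => [|x xv] /=.
    by rewrite fv0.
  by rewrite -(big_morph g gD g0) -gMn -gN -gD fE// gMn g1.
have ERe := solve (@complex.Re R) ReD erefl erefl.
have EReIm : expected_hitting_time P Z v =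
    (complex.Re (f u) + complex.Im (f u))%:E.
  apply: (solve (fun z => complex.Re z + complex.Im z)).
  - by move=> x y /=; rewrite ReD ImD addrACA.
  - exact: addr0.
  - exact: addr0.
rewrite ERe; split=> //=; move: EReIm; rewrite ERe => -[/eqP].
rewrite -subr_eq0 opprD addrA subrr sub0r oppr_eq0 => /eqP Im0.
by case: (f u) Im0 => x y /= ->.
Qed.

End regular_walk.

Lemma card_circulant_nbr N k (x : 'Z_N) : (2 * k < N)%N ->
  #|[set y | circulant k x y]%SET| = (2 * k)%N.
Proof.
(* The cardinal becomes a sum of the constant 1 in [rat], to which the shift formula applies. *)
move=> kN; apply/eqP; rewrite -(eqr_nat rat) -sumr_const big_set sum_circulant//.
by rewrite sumr_const_nat subn1/= mulrnA.
Qed.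

Lemma card_product_nbr N k (p : 'Z_N * petersen_vertex) : (0 < k)%N -> (2 * k < N)%N ->
  #|[set q | cartesian_product (@circulant N k) petersen p q]%SET| = (2 * k + 3)%N.
Proof.
case: p => x b k0 kN.
rewrite -(card_circulant_nbr x kN) -(card_petersen_nbr b); apply/eqP.
rewrite -(eqr_nat rat) natrD.
rewrite -!sumr_const !big_set sum_cartesian_product//.
  by apply: circulant_irr; lia.
exact: petersen_irr.
Qed.

(** By symmetry of the graph the values of the Laplacian of [h] sum to 0. The [N - 1] vertices other
    than [l] contribute [2 k] each, which determines the value at [l]. *)
Lemma circulant_potential_defect (F : numFieldType) N k (h : 'Z_N -> F) l :
  (0 < k)%N -> (2 * k < N)%N ->
  (forall x, x != l ->
     2 * k%:R * h x - \sum_(y | circulant k x y) h y = 2 * k%:R) ->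
  forall x, 2 * k%:R * h x - \sum_(y | circulant k x y) h y =
            2 * k%:R - 2 * k%:R * N%:R * (x == l)%:R.
Proof.
move=> k0 kN hP x; have [->|xl] := eqVneq x l; last by rewrite mulr0 subr0 hP.
have : \sum_x (2 * k%:R * h x - \sum_(y | circulant k x y) h y) = 0.
  rewrite sumrB -mulr_sumr (exchange_big_dep xpredT)//= mulr_sumr -sumrB.
  apply: big1 => y _; rewrite (eq_bigl (circulant k y)) => [|z]; last exact: circulant_sym.
  by rewrite -big_set sumr_const card_circulant_nbr// -[h y *+ _]mulr_natl natrM subrr.
rewrite (bigD1 l)//= [X in _ + X = 0 -> _](eq_bigr (fun=> 2 * k%:R)); last exact: hP.
rewrite sumr_const cardC1 card_ord [(Zp_trunc N).+2.-1](_ : _ = N.-1).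
  2: by rewrite Zp_cast//; lia.
move=> /eqP; rewrite addr_eq0 => /eqP ->; rewrite mulr1 -mulr_natr.
have -> : N%:R = N.-1%:R + 1 :> F by rewrite natr1 prednK//; lia.
by ring.
Qed.

(** A positive maximum is attained away from [l], where the mean value property forces every
    neighbour to be a maximum too. Following the neighbour at [+ 1] around the cycle reaches [l],
    where [f] vanishes. *)
Lemma circulant_max_principle (R : realFieldType) N k (f : 'Z_N -> R) l :
  (0 < k)%N -> (2 * k < N)%N -> f l = 0 ->
  (forall x, x != l -> \sum_(y | circulant k x y) f y = 2 * k%:R * f x) ->
  forall x, f x <= 0.
Proof.
move=> k0 kN fl fP; pose M := [arg max_(z > 0) f z]%O.
have fM y : f y <= f M.
  by rewrite /M; case: arg_maxP => // z _; exact.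
move=> x; apply: le_trans (fM x) _; rewrite leNgt; apply/negP => M0.
have step y : f y = f M -> f (y + 1) = f M.
  move=> fy; have yl : y != l.
    by apply: contraTneq M0 => yl; rewrite -fy yl fl ltxx.
  have : \sum_(1 <= s < k.+1) ((f M - f (y + s%:R)) + (f M - f (y - s%:R))) = 0.
    have := fP _ yl; rewrite sum_circulant// fy => H.
    under eq_bigr do rewrite addrACA -opprD.
    by rewrite sumrB H sumr_const_nat subn1/=; ring.
  rewrite big_nat_recl//=; move/eqP; rewrite paddr_eq0; last 2 first.
  - by rewrite addr_ge0 ?subr_ge0.
  - by rewrite sumr_ge0// => s _; rewrite addr_ge0 ?subr_ge0.
  by rewrite paddr_eq0 ?subr_ge0// => /andP[/andP[+ _] _]; rewrite subr_eq0 => /eqP.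
have all m : f (M + m%:R) = f M.
  by elim: m => [|m IH]; [rewrite addr0|rewrite -natr1 addrA step].
have := all (l - M); rewrite natr_Zp addrC subrK fl => H.
by rewrite -H ltxx in M0.
Qed.

(** The system, with row [l] replaced by the boundary condition, is square. A kernel vector vanishes
    at [l] and is harmonic elsewhere, so the maximum principle for it and its negative makes it
    0. *)
Lemma circulant_potential_exists (R : realFieldType) N k (l : 'Z_N) :
  (0 < k)%N -> (2 * k < N)%N ->
  exists h : 'Z_N -> R, h l = 0 /\ forall x, x != l ->
    2 * k%:R * h x - \sum_(y | circulant k x y) h y = 2 * k%:R.
Proof.
move=> k0 kN.
pose B : 'M[R]_((Zp_trunc N).+2) := \matrix_(x, y)
  if x == l then (y == x)%:R else 2 * k%:R * (y == x)%:R - (circulant k x y)%:R.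
have BE (v : 'cV[R]_((Zp_trunc N).+2)) x : (B *m v) x 0 =
    if x == l then v x 0 else 2 * k%:R * v x 0 - \sum_(y | circulant k x y) v y 0.
  have diag : \sum_y (y == x)%:R * v y 0 = v x 0.
    rewrite (bigD1 x)//= eqxx mul1r big1 ?addr0// => y /negPf ->.
    by rewrite mul0r.
  rewrite mxE; under eq_bigr do rewrite mxE.
  case: ifP => _ //.
  under eq_bigr do rewrite mulrBl -[_ * _ * v _ _]mulrA.
  rewrite sumrB -mulr_sumr diag; congr (_ - _); rewrite [RHS]big_mkcond.
  by apply: eq_bigr => y _; case: circulant; rewrite ?mul1r ?mul0r.
have Bunit : B \in unitmx.
  rewrite -unitmx_tr -row_free_unit; apply: inj_row_free => w wB.
  have {wB} wB x : (B *m w^T) x 0 = 0 by rewrite -[B]trmxK -trmx_mul wB !mxE.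
  have wl : w^T l 0 = 0 by have := wB l; rewrite BE eqxx.
  have wP x : x != l -> \sum_(y | circulant k x y) w^T y 0 = 2 * k%:R * w^T x 0.
    by move=> /negPf xl; have := wB x; rewrite BE xl => /eqP; rewrite subr_eq0 => /eqP.
  apply/rowP => x; rewrite mxE; apply/eqP; rewrite eq_le.
  have -> : w 0 x = w^T x 0 by rewrite mxE.
  rewrite (circulant_max_principle k0 kN wl wP)/= -oppr_le0.
  apply: (@circulant_max_principle _ N k (fun y => - w^T y 0) l) => //.
    by rewrite wl oppr0.
  by move=> y yl; rewrite sumrN wP// mulrN.
pose b : 'cV[R]_((Zp_trunc N).+2) := \col_x if x == l then 0 else 2 * k%:R.
exists (fun x => (invmx B *m b) x 0).
have Bb x : (B *m (invmx B *m b)) x 0 = b x 0 by rewrite mulKVmx.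
split; first by have := Bb l; rewrite BE [b _ _]mxE eqxx.
by move=> x /negPf xl; have := Bb x; rewrite BE [b _ _]mxE xl.
Qed.

(** * The cycle and the corollary *)

(** The gambler's ruin formula: the mean hitting time of 0 from [x] on the cycle, written with the
    representative of [x] in [[0, N)]. *)
Definition cycle_potential (F : numFieldType) N (x : 'Z_N) : F :=
  (x * (N - x))%N%:R.

Lemma cycle_potentialP (F : numFieldType) N (y : 'Z_N) : (2 < N)%N -> y != 0 ->
  2 * 1%:R * cycle_potential F y
    - \sum_(z | circulant 1 y z) cycle_potential F z = 2 * 1%:R.
Proof.
move=> N2 y0; have N1 := ltnW N2.
(* The quadratic formula also holds at [m = N], where both sides are 0; this covers the neighbour
   [y + 1] when it wraps around. *)
have qE m : (m <= N)%N ->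
    cycle_potential F (m%:R : 'Z_N) = m%:R * (N%:R - m%:R).
  move=> mN; rewrite /cycle_potential val_Zp_nat// natrM.
  have [->|mN'] := eqVneq m N; first by rewrite modnn subrr mul0r mulr0.
  have {}mN' : (m < N)%N by rewrite ltn_neqAle mN'.
  by rewrite modn_small// natrB.
rewrite sum_circulant; last by lia.
rewrite big_nat1 -[y]natr_Zp; have : (0 < y)%N by rewrite lt0n.
have : (y < N)%N by rewrite -[X in (_ < X)%N](Zp_cast N1).
case: (nat_of_ord y) => // m mN _.
rewrite natr1 -[m.+1%:R - 1](_ : m%:R = _); last by rewrite -natr1 addrK.
rewrite !qE//; try lia.
by rewrite -!natr1; ring.
Qed.

Section one_root.
Variable R : rcfType.

(** For [k = 1] the only root of [D] is [2 + nu], with derivative [- 1/2], and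
    [gamma ^+ 2 = phi + 2 = 4 + nu]. The choice can be made in the real field:
    [eta = (g + sqrt nu) / 2], whose inverse is the conjugate [(g - sqrt nu) / 2]. *)
Lemma root_choice1 (nu g : R) : 0 < nu -> g ^+ 2 = 4 + nu ->
  exists phi rho eta : 'I_1 -> R, root_choice nu phi rho eta /\
    forall N l, rootA nu phi eta N l =
      - 2 / g * (lucasV g l * lucasV g (N - l) / lucasV g N).
Proof.
move=> nu0 g2.
have DE : polyD 1 nu = (1 + nu / 2)%:P - 2^-1 *: 'X.
  by rewrite /polyD big_nat1 chebyshevT1 comp_polyX.
pose s := Num.sqrt nu.
have s2 : s ^+ 2 = nu by rewrite sqr_sqrtr// ltW.
have gs : (g + s) * (g - s) = 4 by rewrite mulrC -subr_sqr g2 s2 addrK.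
have gs0 : g + s != 0.
  by apply/eqP => H; have /eqP := gs; rewrite H mul0r eq_sym pnatr_eq0.
pose e := (g + s) / 2.
have e0 : e != 0 by rewrite mulf_neq0// invr_eq0 pnatr_eq0.
have eV : e^-1 = (g - s) / 2.
  by apply: (mulfI e0); rewrite mulfV// /e mulrACA gs; field.
have eg : e + e^-1 = g by rewrite eV /e; field.
exists (fun=> 2 + nu), (fun=> e ^+ 2), (fun=> e); split; last first.
  move=> N l; rewrite /rootA big_ord1 /gamma eg DE; congr (_ * _).
  rewrite derivB derivZ derivX derivC !hornerE.
  have g0 : g != 0.
    by apply/eqP => H; move/eqP: g2; rewrite H expr0n/= lt_eqF// ltr_wpDl.
  by field.
split=> //.
- by move=> c c' _; rewrite !ord1.
- move=> z; rewrite DE rootE !hornerE; split.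
    by move=> /eqP H; exists ord0; lra.
  by move=> [_ <-]; apply/eqP; field.
- move=> _; split; first by rewrite expf_neq0.
  rewrite -exprVn (_ : e ^+ 2 + _ = (e + e^-1) ^+ 2 - 2 * (e * e^-1)); last by ring.
  by rewrite eg g2 mulfV//; ring.
Qed.

End one_root.

Theorem corollary6p9 (R : realType) (N k : nat) (hk : (0 < k)%N)
  (hN : (2 * k + 1 <= N)%N) (a : petersen_vertex) (l : nat) (hl : (l < N)%N)
  (d : measure_display) (T : measurableType d) (P : probability T R)
  (Z : nat -> T -> ('Z_N * petersen_vertex)%type)
  (hZ : simple_random_walk P (cartesian_product (@circulant N k) petersen)
          (0, a) Z) :
  (simple_roots (polyD k (2 : R[i])) -> simple_roots (polyD k (5 : R[i])) ->
   forall phi2 rho2 eta2 phi5 rho5 eta5 : 'I_k -> R[i],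
     root_choice 2 phi2 rho2 eta2 -> root_choice 5 phi5 rho5 eta5 ->
   forall (d' : measure_display) (T' : measurableType d')
     (P' : probability T' R) (W : nat -> T' -> 'Z_N),
     simple_random_walk P' (@circulant N k) 0 W ->
     [/\ expected_hitting_time P Z (l%:R, a) \is a fin_num,
         expected_hitting_time P' W l%:R \is a fin_num &
         (fine (expected_hitting_time P Z (l%:R, a)))%:C =
         (2 * k%:R + 3) / (2 * k%:R)
           * (fine (expected_hitting_time P' W l%:R))%:C
         - N%:R * (2 * k%:R + 3) / 2
           * (5 * rootA 2 phi2 eta2 N l + 4 * rootA 5 phi5 eta5 N l)])
  /\
  (k = 1%N ->
   expected_hitting_time P Z (l%:R, a) =
   (5 / 2 * (l * (N - l))%:R
    + 5 * N%:R *
      (5 / Num.sqrt 6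
         * (lucasV (Num.sqrt 6 : R) l * lucasV (Num.sqrt 6 : R) (N - l)
              / lucasV (Num.sqrt 6 : R) N)
       + 4 / 3
         * (lucasV (3 : R) l * lucasV (3 : R) (N - l)
              / lucasV (3 : R) N)))%:E).
Proof.
have kN : (2 * k < N)%N by rewrite -addn1.
have N1 : (1 < N)%N by lia.
have lN := ltnW hl.
have cast (F : numFieldType) m n : (2 * m%:R + n%:R : F) = (2 * m + n)%N%:R.
  by rewrite natrD natrM.
split.
  move=> _ _ phi2 rho2 eta2 phi5 rho5 eta5 rc2 rc5 d' T' P' W rwW.
  have [h [hl0 hP]] := @circulant_potential_exists R N k l%:R hk kN.
  have -> : expected_hitting_time P' W l%:R = (h 0)%:E.
    apply: (expected_hitting_time_regular (m := (2 * k)%N) _ _ rwW hl0).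
    - by rewrite muln_gt0.
    - by move=> x; exact: card_circulant_nbr.
    - by move=> x xl; rewrite -[h x *+ _]mulr_natl natrM hP.
  (* The Green functions come from complex roots, so the real potential is embedded in [R[i]] before
     they are combined. *)
  have hPC (x : 'Z_N) : 2 * k%:R * (h x)%:C - \sum_(y | circulant k x y) (h y)%:C =
      2 * k%:R - 2 * k%:R * N%:R * (x == l%:R)%:R.
    have /(congr1 (real_complex R)) := circulant_potential_defect hk kN hP x.
    by rewrite !(rmorphB, rmorphM, rmorph_sum, rmorph_nat).
  have pos2 : 0 < 2 :> R[i] by rewrite ltr0n.
  have pos5 : 0 < 5 :> R[i] by rewrite ltr0n.
  have [g2 [g2P g2A]] := circulant_green hk kN pos2 rc2.
  have [g5 [g5P g5A]] := circulant_green hk kN pos5 rc5.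
  have hlC : (h l%:R)%:C = 0 :> R[i] by rewrite hl0.
  have [H [Hl HP H0]] := product_potential a hk kN hlC hPC g2P g5P.
  have [fin ->] := expected_hitting_time_regularC (m := (2 * k + 3)%N) ltac:(lia)
    (fun p => card_product_nbr p hk kN) hZ Hl
    ltac:(by move=> p /HP; rewrite cast mulr_natl).
  split=> //; rewrite H0 g2A// g5A//=; field.
  by rewrite pnatr_eq0 -lt0n.
move=> k1; subst k.
have N2 : (2 < N)%N by lia.
pose h (x : 'Z_N) := cycle_potential R (x - l%:R).
have hl0 : h l%:R = 0 by rewrite /h subrr /cycle_potential mul0n.
have hP (x : 'Z_N) : x != l%:R ->
    2 * 1%:R * h x - \sum_(y | circulant 1 x y) h y = 2 * 1%:R.
  rewrite -subr_eq0 => /(cycle_potentialP R N2); rewrite !sum_circulant//.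
  by rewrite !big_nat1 /h (addrAC x 1%:R) (addrAC x (- 1%:R)).
have h0 : h 0 = (l * (N - l))%N%:R.
  rewrite /h /cycle_potential sub0r; have -> : - l%:R = (N - l)%N%:R :> 'Z_N.
    by rewrite natrB// pchar_Zp// sub0r.
  rewrite val_Zp_nat//; have [->|l0] := posnP l.
    by rewrite subn0 modnn !mul0n.
  by rewrite modn_small ?subKn// 1?mulnC//; lia.
have s60 : Num.sqrt 6 != 0 :> R by rewrite gt_eqF// sqrtr_gt0 ltr0n.
have pos2 : 0 < 2 :> R by rewrite ltr0n.
have pos5 : 0 < 5 :> R by rewrite ltr0n.
(* The Lucas parameters are the positive square roots of [4 + nu] for [nu = 2] and [nu = 5]. *)
have sq6 : Num.sqrt 6 ^+ 2 = 4 + 2 :> R by rewrite sqr_sqrtr ?ler0n// -natrD.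
have sq9 : 3 ^+ 2 = 4 + 5 :> R by ring.
have [phi2 [rho2 [eta2 [rc2 A2]]]] := root_choice1 pos2 sq6.
have [phi5 [rho5 [eta5 [rc5 A5]]]] := root_choice1 pos5 sq9.
have [g2 [g2P g2A]] := circulant_green hk kN pos2 rc2.
have [g5 [g5P g5A]] := circulant_green hk kN pos5 rc5.
have [H [Hl HP H0]] := product_potential a hk kN hl0
  (circulant_potential_defect hk kN hP) g2P g5P.
rewrite (expected_hitting_time_regular (m := (2 * 1 + 3)%N) _
    (fun p => card_product_nbr p hk kN) hZ Hl) //; last first.
  by move=> p /HP; rewrite cast mulr_natl.
(* The coefficient [- 2 / g] of each root sum, halved by the Green function, cancels the minus sign
   in the formula for [H (0, a)]. *)
congr _%:E; rewrite H0 h0 g2A// g5A// A2 A5.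
move: (_ / lucasV _ N) (_ / lucasV 3 N) => X2 X5.
by field; rewrite s60.
Qed.
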